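(* Let $T$ be a singular weighted tree with $n$ vertices. The following are equivalent: (i) The number of alternating paths in $T$ is $n-1$. (ii) $T^{\#}$ is a tree. (iii) $T$ is a star. (iv) $T^{\#}$ is isomorphic to $T$.
   Context: A weighted tree has a nonzero real weight on each edge; it is singular if its adjacency matrix $A$ ($(i,j)$ entry equal to the weight of edge $v_iv_j$, or $0$ if no edge) is singular. $A^{\#}$ is the group inverse of $A$ (unique $X$ with $AXA=A$, $XAX=X$, $AX=XA$); $T^{\#}$ is the weighted graph on the vertex set of $T$ with $v_iv_j$ an edge iff $(A^{\#})_{ij}\neq 0$, weighted by that entry. Given a maximum matching $M$ of $T$, a path is alternating with respect to $M$ if its edges are alternately in $M$ and not in $M$, with first and last edges in $M$; the alternating paths of $T$ are the paths of $T$ that are alternating with respect to some maximum matching of $T$ (counted as paths, i.e. by their unordered pair of endpoints). Weighted graphs are isomorphic if their underlying unweighted graphs are isomorphic. *)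

(* Defs.v *)
From HB Require Import structures.
From mathcomp Require Import all_boot all_order all_fingroup all_algebra.
From mathcomp Require Import boolp reals.
Set Implicit Arguments. Unset Strict Implicit. Unset Printing Implicit Defensive.
Import Order.TTheory GRing.Theory Num.Theory.
Local Open Scope ring_scope.

(* A weighted graph on the vertex set 'I_n is given by its (weighted)
   adjacency matrix A : 'M[R]_n; v_i v_j is an edge iff i != j and A i j != 0,
   the weight being A i j. *)
Section WGraph.
Variables (R : realType) (n : nat).
Implicit Types (A X : 'M[R]_n).

Definition adj A : rel 'I_n := fun i j => (i != j) && (A i j != 0).

Definition wgraph A := (A^T = A) /\ (forall i, A i i = 0).

Definition connected A := forall i j : 'I_n, connect (adj A) i j.

Definition acyclic A :=
  forall c : seq 'I_n, uniq c -> (2 < size c)%N -> ~~ path.cycle (adj A) c.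

Definition wtree A := [/\ (0 < n)%N, wgraph A, connected A & acyclic A].

Definition singular A := \det A = 0.

Definition group_inverse A X :=
  [/\ A *m X *m A = A, X *m A *m X = X & A *m X = X *m A].

Definition edges A : {set {set 'I_n}} :=
  [set e | [exists i, exists j, adj A i j && (e == [set i; j])]].

Definition matching A (M : {set {set 'I_n}}) :=
  (M \subset edges A) &&
  [forall e in M, forall f in M, (e != f) ==> [disjoint e & f]].

Definition max_matching A (M : {set {set 'I_n}}) :=
  matching A M && [forall M' : {set {set 'I_n}}, matching A M' ==> (#|M'| <= #|M|)%N].

Definition is_path A (u : 'I_n) (q : seq 'I_n) :=
  [&& q != [::], uniq (u :: q) & path (adj A) u q].

(* edges of u :: q alternate in M / not in M, first and last edge in M *)
Definition alternating (M : {set {set 'I_n}}) (u : 'I_n) (q : seq 'I_n) :=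
  odd (size q) &&
  all (fun p : {set 'I_n} * nat => (p.1 \in M) == ~~ odd p.2)
      (zip (pairmap (fun x y => [set x; y]) u q) (iota 0 (size q))).

(* alternating paths of T, counted by their unordered pair of endpoints *)
Definition alt_paths A : {set {set 'I_n}} :=
  [set S | `[< exists (u : 'I_n) (q : seq 'I_n) (M : {set {set 'I_n}}),
              [/\ max_matching A M, is_path A u q, alternating M u q
                & S = [set u; last u q]] >]].

Definition star A := exists c : 'I_n, forall i j, adj A i j -> (i == c) || (j == c).

(* isomorphism of the underlying unweighted graphs *)
Definition wgraph_iso A X :=
  exists s : {perm 'I_n}, forall i j, adj X i j = adj A (s i) (s j).

End WGraph.

(* Main.v *)
(* Both for alternating paths and for edges of T#, there is a map from the edges of T to
   the pairs being counted: an edge uv goes to itself when it is such a pair, and otherwise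
   to the ends of a path u' u v v'. A pair determines its path in T, hence its middle edge,
   so there are at least n - 1 pairs. Singularity supplies a vertex d where some null vector
   is nonzero, resp. a vertex missed by some maximum matching; if T is not a star, rerouting
   near a neighbour of d gives two pairs with the same middle edge, hence at least n pairs.
   For T# this rests on A A# being the identity on the rows of the vertices where all null
   vectors vanish, and on A#_dv being nonzero for every edge dv. Conversely the adjacency
   matrix of a star satisfies A^3 = s A, so A# is a scalar multiple of A. *)

Require Import Defs.
From HB Require Import structures.
From mathcomp Require Import all_boot all_order all_fingroup all_algebra.
From mathcomp Require Import boolp reals.
Set Implicit Arguments. Unset Strict Implicit. Unset Printing Implicit Defensive.
Import Order.TTheory GRing.Theory Num.Theory.
Local Open Scope ring_scope.

Lemma set2_eq (T : finType) (a b c d : T) : [set a; b] = [set c; d] ->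
  a = c /\ b = d \/ a = d /\ b = c.
Proof.
move=> E; have := set21 a b; have := set22 a b; have := set21 c d; have := set22 c d.
rewrite -{1 2}E {3 4}E !inE.
by do 4![case/orP => /eqP ?]; subst; auto.
Qed.

(** * Forests: unique paths and the absence of endless walks *)

Section Forest.
Variables (T : finType) (e : rel T).

Definition forest :=
  [/\ symmetric e, irreflexive e
    & forall c : seq T, uniq c -> (2 < size c)%N -> ~~ path.cycle e c].

(** Spelled like [edges], so that [edge_set (adj A)] is convertible to [edges A]. *)
Definition edge_set : {set {set T}} :=
  [set E | [exists i, exists j, e i j && (E == [set i; j])]].

Definition avoid (u : T) : rel T := fun x y => [&& e x y, x != u & y != u].

Lemma edge_setP (E : {set T}) :
  reflect (exists i j, e i j /\ E = [set i; j]) (E \in edge_set).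
Proof.
rewrite inE; apply: (iffP existsP) => [[i /existsP[j /andP[eij /eqP->]]]|].
  by exists i, j.
by move=> [i [j [eij ->]]]; exists i; apply/existsP; exists j; rewrite eij eqxx.
Qed.

Lemma path_avoid (u a : T) (p : seq T) :
  path e a p -> u \notin a :: p -> connect (avoid u) a (last a p).
Proof.
elim: p a => [|b p IH] a /=; first by rewrite connect0.
rewrite !inE !negb_or => /andP[eab pb] /and3P[ua ub up].
apply: (@connect_trans _ _ b); last by apply: IH => //; rewrite inE negb_or ub.
by apply: connect1; rewrite /avoid eab !(eq_sym _ u) ua ub.
Qed.

Hypothesis fe : forest.

Lemma forest_sym : symmetric e. Proof. by case: fe. Qed.

Lemma forest_neq x y : e x y -> x != y.
Proof. by case: fe => _ eirr _; apply: contraL => /eqP->; rewrite eirr. Qed.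

Lemma avoid_connect_sym u : connect_sym (avoid u).
Proof.
by apply: sym_connect_sym => x y; rewrite /avoid forest_sym [(x != u) && _]andbC.
Qed.

(* Two neighbours of u joined by a walk avoiding u would close up a cycle through u. *)
Lemma forest_branch (u a b : T) :
  e u a -> e u b -> connect (avoid u) a b -> a = b.
Proof.
case: fe => esym eirr eacy eua eub /connectP[p pp lp]; rewrite {b}lp in eub *.
case/shortenP: pp eub => q pq uq _ eub.
case: q pq uq eub => [//|b q] pq uq eub.
have uneq : u \notin a :: b :: q.
  apply/negP; rewrite inE => /orP[/eqP ua|]; first by rewrite ua eirr in eua.
  elim: (b :: q) a pq {uq eub eua} => [//|c s IH] a /=.
  move=> /andP[/and3P[_ _ cu] ps]; rewrite inE eq_sym (negPf cu) /=; exact: IH ps.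
have /negP[] : ~~ path.cycle e [:: u, a, b & q] by apply: eacy => //; rewrite cons_uniq uneq.
rewrite /path.cycle rcons_path [last _ _]/= esym eub andbT [path _ _ _]/= eua.
by apply: sub_path pq => x y /and3P[].
Qed.

(** Two paths leaving [u] through different neighbours and ending at the same vertex would join
    these neighbours by a walk avoiding [u], against [forest_branch]. *)
Lemma forest_unique_path (u : T) (p q : seq T) :
  path e u p -> path e u q -> uniq (u :: p) -> uniq (u :: q) ->
  last u p = last u q -> p = q.
Proof.
elim: p u q => [|a p IH] u [|b q] //=.
- by move=> _ _ _ /andP[uq _] eqL; rewrite eqL mem_last in uq.
- by move=> _ _ /andP[uq _] _ eqL; rewrite -eqL mem_last in uq.
move=> /andP[ea pa] /andP[eb pb] /andP[ua upa] /andP[ub upb] eqL.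
have conA := path_avoid pa ua; have conB := path_avoid pb ub.
have ab : a = b.
  apply: (forest_branch ea eb); apply: (connect_trans conA).
  by rewrite eqL avoid_connect_sym.
by subst b; rewrite (IH a q).
Qed.

(** A walk along [W] never turns back, and revisiting a vertex would close a cycle; so it would grow
    beyond the number of vertices. *)
Lemma forest_no_walk (W : T -> T -> Prop) :
  (forall x y, W x y -> e x y) ->
  (forall x y, W x y -> exists z, z != x /\ W y z) ->
  forall x y, ~ W x y.
Proof.
case: fe => esym eirr eacy We Wstep x0 y0 W0.
(* The walk is stored with its latest vertex [y] first. *)
have long k : exists x y s, [/\ size s = k, W x y, path e y (x :: s) & uniq [:: y, x & s]].
  elim: k => [|k [x [y [s [ss Wxy ps us]]]]].
    exists x0, y0, [::]; split => //=; first by rewrite esym We.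
    by rewrite inE andbT eq_sym forest_neq // We.
  have [z [zx Wyz]] := Wstep _ _ Wxy; have eyz := We _ _ Wyz.
  exists y, z, (x :: s); split => //=; first by rewrite ss.
    by rewrite esym eyz.
  rewrite -/(uniq [:: y, x & s]) us andbT; apply/negP.
  rewrite inE eq_sym (negPf (forest_neq eyz)) inE (negPf zx) /= => zs.
  case/splitPr: zs ps us {ss} => s1 s2 ps us.
  (* Since [z] differs from [x] and [y], the repetition lies in [s], and the closed cycle has at
     least three vertices. *)
  have /negP[] : ~~ path.cycle e (y :: x :: rcons s1 z).
    apply: eacy; last by rewrite /= size_rcons.
    move: us; rewrite -cat_rcons -!cat_cons cat_uniq; by case/andP.
  rewrite /path.cycle rcons_path [last _ _]/= last_rcons [e z y]esym eyz andbT.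
  by move: ps; rewrite -cat_rcons -cat_cons cat_path => /andP[].
have [x [y [s [ss _ _ us]]]] := long #|T|.
by have := max_card (mem [:: y, x & s]); rewrite (card_uniqP us) /= ss ltnNge leqnSn.
Qed.

End Forest.

(** * Counting pairs of vertices by their middle edge *)

Section Counting.
Variables (T : finType) (e : rel T).
Hypotheses (fe : forest e) (conn : forall x y, connect e x y).

(* The edges of a tree rooted at r correspond to the non-root vertices: v is sent
   to the first edge of the path from v to r. *)
Lemma card_tree_edges (r : T) : #|edge_set e| = #|T|.-1.
Proof.
have /choice[f fP] v : exists q, [/\ path e v q, uniq (v :: q) & last v q = r].
  have /connectP[p pp ->] := conn v r.
  by case/shortenP: pp => q pq uq _; exists q.
have fE v q : path e v q -> uniq (v :: q) -> last v q = r -> f v = q.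
  move=> pq uq lq; have [pf uf lf] := fP v.
  by apply: (forest_unique_path fe pf pq uf uq); rewrite lf.
have fN v : v != r -> exists w, exists2 q, f v = w :: q & e v w.
  move=> vr; have [] := fP v; case: (f v) => [|w q] /=.
    by move=> _ _ vr'; rewrite vr' eqxx in vr.
  by case/andP=> evw _ _ _; exists w, q.
pose g v := [set v; head v (f v)].
have ginj : {in [set~ r] &, injective g}.
  move=> v w; rewrite !inE => vr wr.
  have [v' [q fv _]] := fN v vr; have [w' [s fw _]] := fN w wr.
  rewrite /g fv fw /= => /set2_eq[[]//|[vw' wv']]; subst v' w'.
  (* Here [v] and [w] are each other's first step, so [v] would occur again on its own path. *)
  have [] := fP v; rewrite fv /= => /andP[_ pq] /andP[vq uq] lq.
  by rewrite (fE _ _ pq uq lq) in fw; rewrite fw !inE eqxx orbT in vq.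
suff -> : edge_set e = g @: [set~ r] by rewrite (card_in_imset ginj) cardsC1.
apply/setP => E; apply/edge_setP/imsetP => [[x [y [exy ->]]]|[v]]; last first.
  by rewrite !inE => /fN[w [q fv evw]] ->; exists v, w; rewrite /g fv.
have first a b : e a b -> b \in f a -> a != r /\ head a (f a) = b.
  move=> eab bfa; have [pf uf lf] := fP a.
  split; first by apply: contraTneq bfa => ar; rewrite (fE a [::]).
  case/splitPr: bfa pf uf {lf} => s1 s2; rewrite -cat_rcons -cat_cons cat_path cat_uniq.
  move=> /andP[p1 _] /andP[u1 _].
  have pab : path e a [:: b] by rewrite /= eab.
  have uab : uniq [:: a; b] by rewrite /= inE (forest_neq fe eab).
  by rewrite (forest_unique_path fe p1 pab u1 uab) // last_rcons.
(* Either [y] lies on the path of [x], or prefixing [y] to that path gives the path of [y]. *)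
have [yfx|yfx] := boolP (y \in f x).
  by have [xr hx] := first _ _ exy yfx; exists x; rewrite ?inE // /g hx.
have [pf uf lf] := fP x; have fy : f y = x :: f x.
  apply: fE => //; first by rewrite /= (forest_sym fe) exy.
  by rewrite cons_uniq uf inE negb_or yfx eq_sym (forest_neq fe exy).
have eyx : e y x by rewrite (forest_sym fe).
have [|yr hy] := first _ _ eyx; first by rewrite fy mem_head.
by exists y; rewrite ?inE // /g hy setUC.
Qed.

Definition middle (S E : {set T}) :=
  (E \in edge_set e /\ S = E) \/
  exists a b c d, [/\ path e a [:: b; c; d], uniq [:: a; b; c; d],
                      S = [set a; d] & E = [set b; c]].

(** Puts both shapes of [middle] in the form of one path [a :: q], with [a = b] for a single edge,
    so that uniqueness of paths applies to both at once. *)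
Lemma middleP (S E : {set T}) : middle S E -> exists a b c q,
  [/\ path e a q, uniq (a :: q), S = [set a; last a q], E = [set b; c]
    & q = [:: c] /\ a = b \/ exists d, q = [:: b; c; d]].
Proof.
move=> [[/edge_setP[x [y [exy ->]]] ->]|[a [b [c [d [pq uq -> ->]]]]]].
  exists x, x, y, [:: y]; split => //=; first by rewrite exy.
    by rewrite inE andbT (forest_neq fe).
  by left.
by exists a, b, c, [:: b; c; d]; split => //; right; exists d.
Qed.

(** The two ends determine the path up to reversal, and reversal preserves the middle edge. *)
Lemma middle_inj (S E E' : {set T}) : middle S E -> middle S E' -> E = E'.
Proof.
move=> /middleP[a [b [c [q [pq uq -> -> qE]]]]].
move=> /middleP[a' [b' [c' [q' [pq' uq' /set2_eq[[aa' lq]|[aq' lq]] -> qE']]]]].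
  subst a'; have qq := forest_unique_path fe pq pq' uq uq' lq; subst q'.
  by case: qE qE' => [[-> ->]|[d ->]] [[]|[d' []]] // [] -> -> //.
(* The ends are swapped: the second path is compared with the reversal of the first. *)
have pr : path e a' (rev (belast a q)).
  rewrite -lq; have : path (fun x y => e y x) (last a q) (rev (belast a q)) by rewrite rev_path.
  by apply: sub_path => x y /=; rewrite (forest_sym fe).
have ur : uniq (a' :: rev (belast a q)).
  by rewrite -lq -rev_rcons -lastI rev_uniq.
have lr : last a' (rev (belast a q)) = last a' q'.
  rewrite -aq'; case: (q) qE => [|x s] /=; last by rewrite rev_cons last_rcons.
  by case=> [[]|[]].
have qq := forest_unique_path fe pr pq' ur uq' lr; subst q'.
case: qE lq qE' {pq uq pr ur lr pq' uq' aq'} => [[-> ->]|[d ->]] /= <-.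
  by case=> [[[->] ->]|[? []]//]; rewrite setUC.
by rewrite /rev /=; case=> [[]//|[? [-> -> _]]]; rewrite setUC.
Qed.

(** Choosing for each edge a pair in [P] with that middle is injective by [middle_inj]; the choice
    takes at most one of [S0] and [S1], so the other is left over. *)
Lemma middle_card_lt (P : {set {set T}}) (E0 S0 S1 : {set T}) :
  (forall E, E \in edge_set e -> exists S, S \in P /\ middle S E) ->
  S0 \in P -> S1 \in P -> S0 != S1 -> middle S0 E0 -> middle S1 E0 ->
  (#|edge_set e| < #|P|)%N.
Proof.
move=> cov P0 P1 S01 m0 m1.
have /choice[f fP] E : exists S, E \in edge_set e -> S \in P /\ middle S E.
  have [/cov[S SP]|] := boolP (E \in edge_set e); first by exists S.
  by exists E.
have finj : {in edge_set e &, injective f}.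
  move=> E E' /fP[_ mE] /fP[_ mE'] ff.
  by rewrite ff in mE; apply: middle_inj mE mE'.
suff [S SP Sf] : exists2 S, S \in P & S \notin f @: edge_set e.
  rewrite -(card_in_imset finj); apply/proper_card/properP; split; last by exists S.
  by apply/subsetP => _ /imsetP[E /fP[]? _ ->].
have notin S : middle S E0 -> S != f E0 -> S \notin f @: edge_set e.
  move=> mS Sf; apply/imsetP => -[E /fP[_ mE] SE].
  by rewrite SE in mS Sf; rewrite (middle_inj mE mS) eqxx in Sf.
have [S0f|S0f] := eqVneq S0 (f E0); last by exists S0 => //; apply: notin.
by exists S1 => //; apply: notin => //; rewrite -S0f eq_sym.
Qed.

Lemma forest_no_triangle u a b : e u a -> e u b -> ~~ e a b.
Proof.
move=> ea eb; apply/negP => eab; have := forest_neq fe eab.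
rewrite (forest_branch fe ea eb) ?eqxx //; apply: connect1.
by rewrite /avoid eab ![_ == u]eq_sym !(forest_neq fe).
Qed.

Lemma not_star_path a : ~ (forall i j, e i j -> (i == a) || (j == a)) ->
  exists v y, [/\ e a v, e v y & y != a].
Proof.
move=> nstar; apply: contrapT => nex; apply: nstar => i j eij.
have near2 v y : e a v -> e v y -> y == a.
  by move=> eav evy; apply/negPn/negP => ya; apply: nex; exists v, y.
(* Neighbours of neighbours of [a] are [a] itself, so a path from [a] never gets beyond the
   neighbours of [a]. *)
suff /orP[->//|eai] : (i == a) || e a i by rewrite (near2 i j) ?orbT.
have /connectP[p] := conn a i.
have : (a == a) || e a a by rewrite eqxx.
elim: p {1 4 5 6}a => [|w p IH] x /= ax; first by move=> _ ->.
case/andP=> exw pw lw; apply: (IH w) => //.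
case/orP: ax => [/eqP xa|/near2/(_ exw)->//].
by rewrite xa in exw; rewrite exw orbT.
Qed.

(* Every edge is the middle of a pair in P: itself if it lies in P1, else the pair of
   ends of a three-edge path around it. Unless the tree is a star, some edge is the
   middle of two pairs. D is to be the set of vertices where some null vector is
   nonzero, or the set of vertices missed by some maximum matching. *)
Lemma star_or_many (P1 P : {set {set T}}) (D : T -> Prop) :
  (forall u v, e u v -> [set u; v] \in P1 -> [set u; v] \in P) ->
  (forall u v, e u v -> D u -> [set u; v] \in P1) ->
  (forall u v u', e u v -> e u u' -> u' != v -> [set u; u'] \in P1 -> ~ D v ->
     exists v', [/\ v' != u, e v v' & [set u'; v'] \in P]) ->
  (forall v a y, D v -> e v a -> e v y -> a != y ->
     exists y', [/\ y' != v, e y y' & [set a; y'] \in P]) ->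
  (forall u, ~ D u -> exists u', e u u' /\ [set u; u'] \in P1) ->
  (forall d a, D d -> e d a -> exists d1, [/\ d1 != d, e a d1 & D d1]) ->
  (exists d, D d) ->
  (exists c, forall i j, e i j -> (i == c) || (j == c)) \/
  (#|edge_set e| < #|P|)%N.
Proof.
move=> H0 H1 H2 H2' H3 H4 [d Dd].
have esym := forest_sym fe; have eneq := forest_neq fe.
have mid1 u v : e u v -> middle [set u; v] [set u; v].
  by move=> euv; left; split=> //; apply/edge_setP; exists u, v.
have mid3 a b c x : e a b -> e b c -> e c x -> a != c -> x != b ->
    middle [set a; x] [set b; c].
  move=> eab ebc ecx ac xb; right; exists a, b, c, x; split => //.
    by rewrite /= eab ebc ecx.
  rewrite /= !inE !negb_or (eneq _ _ eab) ac (eneq _ _ ebc) [b == x]eq_sym xb.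
  rewrite (eneq _ _ ecx) !andbT /=; apply/negP => /eqP ax; subst x; rewrite esym in ecx.
  by have /negP[] := forest_no_triangle eab ecx.
have cov E : E \in edge_set e -> exists S, S \in P /\ middle S E.
  case/edge_setP=> [u [v [euv ->]]].
  have [uvP1|uvP1] := boolP ([set u; v] \in P1).
    by exists [set u; v]; split; [apply: H0|apply: mid1].
  have nDu : ~ D u by move=> Du; rewrite H1 in uvP1.
  have nDv : ~ D v by move=> Dv; rewrite setUC H1 // esym in uvP1.
  have [u' [euu' uu'P1]] := H3 _ nDu.
  have u'v : u' != v by apply: contraNneq uvP1 => <-.
  have [v' [v'u evv' SP]] := H2 _ _ _ euv euu' u'v uu'P1 nDv.
  by exists [set u'; v']; split=> //; apply: mid3; rewrite // esym.
(* If [d] has no neighbour, connectedness makes it the only vertex. *)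
have [[a eda]|noa] := pselect (exists a, e d a); last first.
  left; exists d => i j; have /connectP[[|w p] /=] := conn d i.
    by move=> _ -> _; rewrite eqxx.
  by case/andP=> edw; case: noa; exists w.
have [star|/not_star_path[v [y [eav evy ya]]]] :=
  pselect (forall i j, e i j -> (i == a) || (j == a)); first by left; exists a.
right; have eva : e v a by rewrite esym.
have ay : a != y by rewrite eq_sym.
(* If [D v], the edge [vy] is the middle of itself and of a path [a v y y']. *)
have [Dv|nDv] := pselect (D v).
  have [y' [y'v eyy' SP]] := H2' v a y Dv eva evy ay.
  apply: (middle_card_lt cov _ SP _ (mid1 _ _ evy)).
  - exact/H0/H1.
  - apply/negP => /eqP/setP/(_ a); rewrite !inE eqxx (negPf ay) orbF.
    by rewrite (negPf (eneq _ _ eav)).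
  - exact: mid3.
(* Otherwise the edge [av] is the middle of two pairs, starting at two neighbours [d] and [d1] of
   [a] that lie in [D]. *)
have [d1 [d1d ead1 Dd1]] := H4 _ _ Dd eda.
have other x : D x -> e a x -> exists x', [/\ x' != a, e v x', [set x; x'] \in P
    & middle [set x; x'] [set a; v]].
  move=> Dx eax; have xv : x != v by apply/eqP => xv; rewrite xv in Dx.
  have axP1 : [set a; x] \in P1 by rewrite setUC H1 // esym.
  have [x' [x'a evx' SP]] := H2 _ _ _ eav eax xv axP1 nDv.
  by exists x'; split=> //; apply: mid3; rewrite // esym.
have [x [xa evx xP xm]] := other d Dd (etrans (esym _ _) eda).
have [x1 [x1a evx1 x1P x1m]] := other d1 Dd1 ead1.
apply: (middle_card_lt cov xP x1P _ xm x1m).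
apply/negP => /eqP/set2_eq[[dd1 _]|[_ xd1]]; first by rewrite dd1 eqxx in d1d.
by subst x; have /negP[] := forest_no_triangle eav ead1.
Qed.

End Counting.

(** * Null vectors and the entries of the group inverse *)

Lemma sum_neq0_other (V : nmodType) (I : finType) (F : I -> V) (i : I) :
  \sum_j F j = 0 -> F i != 0 -> exists2 j, j != i & F j != 0.
Proof.
move=> F0 Fi; apply: contrapT => nex; case/eqP: Fi; rewrite -F0 (bigD1 i) //=.
rewrite big1 ?addr0 // => j ji; apply/eqP/negPn/negP => Fj.
by apply: nex; exists j.
Qed.

Lemma group_inverse_unique (R : realType) (n : nat) (A X Y : 'M[R]_n) :
  group_inverse A X -> group_inverse A Y -> X = Y.
Proof.
move=> [AXA XAX AX] [AYA YAY AY].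
have E : A *m X = A *m Y.
  by rewrite -{1}AYA -mulmxA AX AY -mulmxA [A *m (_ *m _)]mulmxA AXA.
by rewrite -XAX -AX E AY -mulmxA E mulmxA YAY.
Qed.

Section NullVectors.
Variables (R : realType) (n : nat) (A X : 'M[R]_n).
Hypotheses (wA : wgraph A) (fA : forest (adj A)) (gi : group_inverse A X).

Lemma wgraph_entryC i j : A i j = A j i.
Proof. by case: wA => At _; rewrite -{1}At mxE. Qed.

Lemma adj_entry i j : adj A i j = (A i j != 0).
Proof.
rewrite /adj; have [->|//] := eqVneq i j.
by case: wA => _ ->; rewrite eqxx.
Qed.

Lemma group_inverse_sym : X^T = X.
Proof.
case: wA gi => At _ [AXA XAX AX]; apply: (@group_inverse_unique _ _ A) => //.
by rewrite -At; split; rewrite -!trmx_mul ?mulmxA ?AXA ?XAX // AX.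
Qed.

Lemma group_inverse_entryC i j : X i j = X j i.
Proof. by rewrite -{1}group_inverse_sym mxE. Qed.

Definition null_at (u : 'I_n) := exists z : 'rV[R]_n, z *m A = 0 /\ z 0 u != 0.

Lemma null_sum (z : 'rV[R]_n) b : z *m A = 0 -> \sum_j z 0 j * A j b = 0.
Proof. by move=> /matrixP/(_ 0 b); rewrite !mxE. Qed.

Lemma null_other (z : 'rV[R]_n) a b : z *m A = 0 -> z 0 a != 0 -> adj A a b ->
  exists c, [/\ c != a, adj A b c & z 0 c != 0].
Proof.
move=> zA za; rewrite adj_entry => Aab.
have [|c ca] := sum_neq0_other (null_sum b zA) (i := a); first by rewrite mulf_neq0.
by rewrite mulf_eq0 negb_or => /andP[zc Acb]; exists c; rewrite adj_entry wgraph_entryC.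
Qed.

(** Otherwise [null_other], applied in turn to the two null vectors, continues the edge [uv] to an
    endless walk whose vertices lie alternately in the supports of [z] and [x]. *)
Lemma null_independent u v : adj A u v -> null_at u -> ~ null_at v.
Proof.
move=> auv [z [zA zu]] [x [xA xv]].
pose W a b := adj A a b /\ (z 0 a != 0 /\ x 0 b != 0 \/ x 0 a != 0 /\ z 0 b != 0).
suff nW : ~ W u v by apply: nW; split=> //; left.
apply: (@forest_no_walk _ _ fA W).
- by move=> a b [].
- move=> a b [aab [[za xb]|[xa zb]]].
    by have [c [ca abc zc]] := null_other zA za aab; exists c; split=> //; split=> //; right.
  by have [c [ca abc xc]] := null_other xA xa aab; exists c; split=> //; split=> //; left.
Qed.

Lemma proj_sym : (A *m X)^T = A *m X.
Proof. by case: gi => _ _ AX; rewrite trmx_mul group_inverse_sym wA.1 -AX. Qed.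

(** The rows of [1%:M - A *m X] are null vectors because [A *m X *m A = A], so they vanish at [v];
    symmetry turns this column statement into one on rows. *)
Lemma proj_entry v k : ~ null_at v -> (A *m X) v k = (v == k)%:R.
Proof.
move=> nv; rewrite -proj_sym mxE; apply/eqP; rewrite eq_sym -subr_eq0; apply/negPn/negP => ne.
apply: nv; exists (row k (1%:M - A *m X)); split.
  by rewrite -row_mul mulmxBl mul1mx; case: gi => -> _ _; rewrite subrr row0.
by move: ne; rewrite !mxE [k == v]eq_sym.
Qed.

(** Since [A] and [X] commute, [X = X *m X *m A], so [X] kills whatever [A] kills. *)
Lemma null_orthogonal (q : 'rV[R]_n) v : q *m A = 0 -> \sum_k X v k * q 0 k = 0.
Proof.
case: gi => _ XAX AX qA.
have Aq : A *m q^T = 0 by rewrite -{1}wA.1 -trmx_mul qA trmx0.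
have Xq : X *m q^T = 0.
  by rewrite -XAX -[X *m A *m X]mulmxA AX mulmxA -mulmxA Aq mulmx0.
have /matrixP/(_ v 0) := Xq; rewrite !mxE => Xqv.
by rewrite -[RHS]Xqv; apply: eq_bigr => k _; rewrite mxE.
Qed.

(** [S] is the component of [v] after deleting [u]. An edge leaving it must end at [u], and by
    [forest_branch] [u] has only the neighbour [v] there. *)
Lemma forest_cut u v : adj A u v -> exists S : {set 'I_n},
  [/\ v \in S, u \notin S & forall j k, j \in S -> k \notin S -> A j k != 0 -> j = v /\ k = u].
Proof.
move=> auv; exists [set k | connect (avoid (adj A) u) v k].
have avu : v != u by rewrite eq_sym (forest_neq fA).
have uS : ~~ connect (avoid (adj A) u) v u.
  apply/negP => /connectP[p pp lp].
  case/lastP: p => [|p w] in pp lp; first by rewrite /= lp eqxx in avu.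
  by move: pp lp; rewrite rcons_path last_rcons => /andP[_ /and3P[_ _ wu]] uw; rewrite uw eqxx in wu.
split; [by rewrite inE connect0|by rewrite inE|move=> j k; rewrite !inE => vj vk].
rewrite -adj_entry => ajk.
have ju : j != u by apply: contraNneq uS => ju; rewrite -{2}ju.
have ku : k = u.
  apply/eqP/negPn/negP => ku; case/negP: vk; apply: (connect_trans vj).
  by apply: connect1; rewrite /avoid ajk ju.
split=> //; apply/esym/(forest_branch fA auv _ vj).
by rewrite (forest_sym fA) -ku.
Qed.

Section Cut.
Variables (u v : 'I_n) (S : {set 'I_n}).
Hypotheses (vS : v \in S) (uS : u \notin S)
  (cut : forall j k, j \in S -> k \notin S -> A j k != 0 -> j = v /\ k = u).

Definition restrict (q : 'rV[R]_n) : 'rV[R]_n := \row_k (if k \in S then q 0 k else 0).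

Lemma restrict_mul q k : (restrict q *m A) 0 k = \sum_(j in S) q 0 j * A j k.
Proof.
rewrite mxE [RHS]big_mkcond; apply: eq_bigr => j _.
by rewrite mxE; case: ifP; rewrite ?mul0r.
Qed.

(** Only the edge [uv] crosses the cut, so truncating [q] to [S] disturbs [q *m A] inside [S] only
    at [v], and leaks outside [S] only to [u]. *)
Lemma restrict_mul_out q k : k \notin S ->
  (restrict q *m A) 0 k = (k == u)%:R * (q 0 v * A v u).
Proof.
move=> kS; rewrite restrict_mul (bigD1 v) //= big1 ?addr0 => [|j /andP[jS jv]].
  have [->|ku] := eqVneq k u; first by rewrite mul1r.
  rewrite mul0r; apply/eqP; rewrite mulf_eq0; apply/orP; right; apply: contra_neqT ku.
  by move=> /cut[] // _ ->.
apply/eqP; rewrite mulf_eq0; apply/orP; right; apply: contra_neqT jv.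
by move=> /cut[] // ->.
Qed.

Lemma restrict_mul_in q k : k \in S ->
  (restrict q *m A) 0 k = (q *m A) 0 k - (k == v)%:R * (q 0 u * A u v).
Proof.
move=> kS; rewrite restrict_mul mxE [in RHS](bigID (mem S)) /=.
suff -> : \sum_(i | i \notin S) q 0 i * A i k = (k == v)%:R * (q 0 u * A u v).
  by rewrite addrK.
rewrite (bigD1 u) //= big1 ?addr0 => [|j /andP[jS ju]].
  have [->|kv] := eqVneq k v; first by rewrite mul1r.
  rewrite mul0r; apply/eqP; rewrite mulf_eq0; apply/orP; right; apply: contra_neqT kv.
  by rewrite wgraph_entryC => /cut[] // ->.
apply/eqP; rewrite mulf_eq0; apply/orP; right; apply: contra_neqT ju.
by rewrite wgraph_entryC => /cut[] // _ ->.
Qed.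

End Cut.

(* If X u v = 0, then x = row v of X solves x A = e_v. As x is orthogonal to the null
   vectors, it lives on v's side of the edge uv, and there the null vector z differs
   from a nonzero multiple of x by a null vector: then x is orthogonal to itself. *)
Lemma null_edge_entry u v : adj A u v -> null_at u -> X u v != 0.
Proof.
move=> auv nu; apply/eqP => Xuv; have nv := null_independent auv nu.
have [z [zA zu]] := nu; have [S [vS uS cut]] := forest_cut auv.
have Auv : A u v != 0 by rewrite -adj_entry.
have zv : z 0 v = 0 by apply/eqP/negPn/negP => zv; apply: nv; exists z.
pose x := row v X.
have xA k : (x *m A) 0 k = (v == k)%:R.
  by rewrite -row_mul mxE; case: gi => _ _ <-; apply: proj_entry.
have xu : x 0 u = 0 by rewrite mxE group_inverse_entryC.
have orth (q : 'rV[R]_n) : q *m A = 0 -> \sum_k x 0 k * q 0 k = 0.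
  by move=> qA; rewrite -[RHS](null_orthogonal v qA); apply: eq_bigr => k _; rewrite mxE.
(* The part of [x] off [S]. As [x] vanishes at [u], its image under [A] can be nonzero only at
   [u]. *)
pose p := x - restrict S x.
have pA k : (p *m A) 0 k = - ((k == u)%:R * (x 0 v * A v u)).
  rewrite mulmxBl mxE [in X in _ + X]mxE.
  have [kS|kS] := boolP (k \in S).
    rewrite (restrict_mul_in uS cut) // xu mul0r mulr0 subr0 subrr.
    by rewrite (_ : k == u = false) ?mul0r ?oppr0 //; apply: contraNF uS => /eqP <-.
  rewrite (restrict_mul_out vS cut) // xA.
  by rewrite (_ : v == k = false) ?sub0r //; apply: contraNF kS => /eqP <-.
(* Pair [p *m A], supported at [u], with the null vector [z], nonzero at [u]. *)
have xv : x 0 v = 0.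
  have : (p *m A *m z^T) 0 0 = 0.
    by rewrite -mulmxA -{1}wA.1 -trmx_mul zA trmx0 mulmx0 mxE.
  rewrite mxE (bigD1 u) //= big1 => [|k ku]; last by rewrite pA (negPf ku) mul0r oppr0 mul0r.
  rewrite pA eqxx mul1r [_^T _ _]mxE addr0 [A v u]wgraph_entryC => /eqP.
  by rewrite mulf_eq0 oppr_eq0 mulf_eq0 (negPf zu) (negPf Auv) !orbF => /eqP.
have p0 : p *m A = 0.
  by apply/rowP => k; rewrite pA xv mul0r mulr0 oppr0 mxE.
(* [x] is orthogonal to the null vector [p], which is a truncation of [x]; hence [p] is orthogonal
   to itself. *)
have xS k : k \notin S -> x 0 k = 0.
  have : \sum_k (p 0 k) ^+ 2 = 0.
    rewrite -[RHS](orth _ p0); apply: eq_bigr => i _; rewrite !mxE.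
    by case: ifP; rewrite ?subrr ?expr0n ?mulr0 // subr0 expr2.
  move=> /psumr_eq0P p2 kS; have /eqP := p2 (fun i _ => sqr_ge0 _) k isT.
  by rewrite sqrf_eq0 mxE [X in _ + X]mxE [restrict S x _ _]mxE (negPf kS) subr0 => /eqP.
(* Truncating [z] leaves the residue [- (z 0 u * A u v)] at [v]; as [x *m A] is the unit vector at
   [v], this multiple of [x] cancels it. *)
pose q := restrict S z + (z 0 u * A u v) *: x.
have qA : q *m A = 0.
  apply/rowP => k; rewrite mulmxDl -scalemxAl [LHS]mxE [X in _ + X]mxE xA [RHS]mxE.
  have [kS|kS] := boolP (k \in S).
    by rewrite (restrict_mul_in uS cut) // zA mxE sub0r eq_sym mulrC addNr.
  rewrite (restrict_mul_out vS cut) // zv mul0r mulr0 add0r.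
  by rewrite (_ : v == k = false) ?mulr0 //; apply: contraNF kS => /eqP <-.
(* [x] is orthogonal to [q] and [z], and [restrict S z] agrees with [z] where [x] lives; subtracting
   leaves a nonzero multiple of this sum. *)
have x2 : \sum_k (x 0 k) ^+ 2 = 0.
  apply: (mulfI (mulf_neq0 zu Auv)); rewrite mulr0 -[RHS](orth _ qA) mulr_sumr.
  rewrite -[LHS]add0r -[X in X + _](orth _ zA) -big_split /=; apply: eq_bigr => k _.
  rewrite [q _ _]mxE [X in _ * (X + _)]mxE [X in _ * (_ + X)]mxE mulrDr expr2.
  rewrite [X in _ = _ + X]mulrCA; congr (_ + _).
  by case: ifP => // /negbT/xS ->; rewrite !mul0r.
have := xA v; rewrite mxE eqxx big1 => [/eqP|k _]; first by rewrite eq_sym oner_eq0.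
have /eqP : x 0 k ^+ 2 = 0 by apply: (psumr_eq0P _ x2) => // i _; apply: sqr_ge0.
by rewrite sqrf_eq0 => /eqP ->; rewrite mul0r.
Qed.

End NullVectors.

(** * Edges of weighted trees; edges of the group inverse of a singular tree *)

Lemma mem_edge_set (T : finType) (e : rel T) u v :
  symmetric e -> ([set u; v] \in edge_set e) = e u v.
Proof.
move=> esym; apply/edge_setP/idP => [[i [j [eij /set2_eq[[-> ->]|[-> ->]]]]]|] //.
  by rewrite esym.
by exists u, v.
Qed.

Lemma wtree_forest (R : realType) (n : nat) (A : 'M[R]_n) : wtree A -> forest (adj A).
Proof.
case=> _ [At _] _ acA; split=> // [i j|i]; last by rewrite /adj eqxx.
by rewrite /adj eq_sym -{1}At mxE.
Qed.

Lemma wtree_card_edges (R : realType) (n : nat) (A : 'M[R]_n) : wtree A -> #|edges A| = n.-1.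
Proof.
move=> tA; have fA := wtree_forest tA; case: tA => n0 _ conA _.
by rewrite -[n in RHS]card_ord; apply: (card_tree_edges fA conA (Ordinal n0)).
Qed.

Section SingularTree.
Variables (R : realType) (n : nat) (A X : 'M[R]_n).
Hypotheses (tA : wtree A) (sA : singular A) (gi : group_inverse A X).

Let wA : wgraph A. Proof. by case: tA. Qed.
Let fA : forest (adj A). Proof. exact: wtree_forest. Qed.
Let conA : connected A. Proof. by case: tA. Qed.

Lemma singular_null_at : exists u, null_at A u.
Proof.
have /eqP/det0P[z z0 zA] := sA; have /rV0Pn[u zu] := z0.
by exists u, z.
Qed.

(** [star_or_many] with [null_at A] as [D] and the edges of [X] as both families; the required edges
    of [X] come from rows of [A *m X] that are rows of the identity. *)
Lemma star_or_many_inverse_edges : star A \/ (#|edges A| < #|edges X|)%N.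
Proof.
have Xsym := group_inverse_entryC wA gi.
have memX u v : ([set u; v] \in edge_set (adj X)) = adj X u v.
  by apply: mem_edge_set => i j; rewrite /adj eq_sym Xsym.
have H1 u v : adj A u v -> null_at A u -> [set u; v] \in edge_set (adj X).
  by move=> auv nu; rewrite memX /adj (forest_neq fA auv) (null_edge_entry wA fA gi).
have H2 u v u' : adj A u v -> adj A u u' -> u' != v ->
    [set u; u'] \in edge_set (adj X) -> ~ null_at A v ->
    exists v', [/\ v' != u, adj A v v' & [set u'; v'] \in edge_set (adj X)].
  move=> auv auu' u'v; rewrite memX => /andP[_ Xuu'] nv.
  (* This off-diagonal entry of [A *m X] is a zero sum with a nonzero term at [u], hence with
     another one at some [v']. *)
  have := proj_entry wA gi u' nv; rewrite eq_sym (negPf u'v) mxE => AX0.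
  have [|v' v'u] := sum_neq0_other AX0 (i := u).
    by rewrite mulf_neq0 // (wgraph_entryC wA) -adj_entry.
  rewrite mulf_eq0 negb_or -adj_entry // => /andP[avv' Xv'u'].
  exists v'; split=> //; rewrite memX /adj Xsym Xv'u' andbT.
  apply/negP => /eqP u'v'; rewrite -u'v' in avv'.
  by have /negP[] := forest_no_triangle fA auv auu'.
apply: (@star_or_many _ _ fA conA (edge_set (adj X)) (edge_set (adj X)) (null_at A)) => //.
- move=> v a y nv ava avy ay.
  by apply: (H2 v) => //; [apply: H1|apply: null_independent nv].
- move=> u nu; have := proj_entry wA gi u nu; rewrite eqxx mxE => AX1.
  have [j] : exists j, A u j * X j u != 0.
    apply: contrapT => nex; have /eqP := oner_neq0 R; apply; apply: etrans (esym AX1) _.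
    by rewrite big1 // => j _; apply/eqP/negPn/negP => ne; apply: nex; exists j.
  rewrite mulf_eq0 negb_or -adj_entry // => /andP[auj Xju].
  by exists j; split=> //; rewrite memX /adj Xsym Xju (forest_neq fA auj).
- move=> d a [z [zA zd]] ada; have [c [cd aac zc]] := null_other wA zA zd ada.
  by exists c; split=> //; exists z.
- exact: singular_null_at.
Qed.

(** * Maximum matchings and alternating paths *)

Lemma matchingP (M : {set {set 'I_n}}) :
  reflect ((forall E, E \in M -> E \in edges A) /\
           (forall E F x, E \in M -> F \in M -> x \in E -> x \in F -> E = F))
          (matching A M).
Proof.
apply: (iffP andP) => [[/subsetP sub /forall_inP dis]|[sub dis]]; split=> //.
- move=> E F x EM FM xE xF; apply/eqP/negPn/negP => EF.
  have /forall_inP/(_ F FM)/implyP/(_ EF) := dis E EM.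
  by move=> /pred0P/(_ x) /=; rewrite xE xF.
- exact/subsetP.
- apply/forall_inP => E EM; apply/forall_inP => F FM; apply/implyP => EF.
  by apply/pred0P => x /=; apply/negP => /andP[xE xF]; rewrite (dis E F x) ?eqxx in EF.
Qed.

Lemma max_matchingP (M : {set {set 'I_n}}) :
  reflect (matching A M /\ forall M', matching A M' -> (#|M'| <= #|M|)%N) (max_matching A M).
Proof.
by apply: (iffP andP) => -[mM maxM]; split=> //; [move=> M' mM'|];
  [apply: (implyP (forallP maxM M'))|apply/forallP => M'; apply/implyP/maxM].
Qed.

Lemma max_matching_exists : exists M, max_matching A M.
Proof.
have m0 : matching A set0 by apply/matchingP; split=> E; rewrite ?inE // => F x; rewrite inE.
exists [arg max_(M > set0 | matching A M) #|M|].
by case: arg_maxnP => // M mM maxM; apply/max_matchingP.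
Qed.

Lemma matching_adj M u v : matching A M -> [set u; v] \in M -> adj A u v.
Proof.
by move=> /matchingP[sub _] /sub; rewrite (mem_edge_set u v (forest_sym fA)).
Qed.

Lemma matching_mate M u v w : matching A M -> [set u; v] \in M -> [set u; w] \in M -> v = w.
Proof.
move=> mM uvM uwM; have /matchingP[_ dis] := mM.
have /set2_eq[[]//|[uw _]] := dis _ _ u uvM uwM (set21 _ _) (set21 _ _).
by have := forest_neq fA (matching_adj mM uwM); rewrite -uw eqxx.
Qed.

Definition missed (M : {set {set 'I_n}}) (v : 'I_n) := forall w, [set v; w] \notin M.

Lemma missed_or_mate M v : missed M v \/ exists w, [set v; w] \in M.
Proof.
have [[w vw]|nex] := pselect (exists w, [set v; w] \in M); first by right; exists w.
by left=> w; apply/negP => vw; apply: nex; exists w.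
Qed.

Lemma matching_extend M u v : matching A M -> missed M u -> missed M v -> adj A u v ->
  matching A ([set u; v] |: M).
Proof.
move=> mM uM vM auv; have /matchingP[sub dis] := mM.
have out E x : E \in M -> x \in E -> x \in [set u; v] -> False.
  move=> EM xE; have /edge_setP[i [j [_ Eij]]] := sub _ EM; subst E.
  move: xE EM; rewrite !inE => /orP[]/eqP-> EM => /orP[]/eqP ij; subst;
  by move: EM; apply/negP; first [exact: uM|exact: vM|rewrite setUC; exact: uM|rewrite setUC; exact: vM].
apply/matchingP; split=> [E|E F x].
  by rewrite inE => /orP[|/sub//]; rewrite inE => /eqP ->; rewrite (mem_edge_set u v (forest_sym fA)).
rewrite !(in_setU1 _ _ M) => /predU1P[->|EM] /predU1P[->|FM] xE xF //.
- by case: (out F x).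
- by case: (out E x).
- exact: dis xF.
Qed.

Lemma max_matching_mate M u v : max_matching A M -> missed M u -> adj A u v ->
  exists w, [set v; w] \in M.
Proof.
move=> /max_matchingP[mM maxM] uM auv; have [vM|//] := missed_or_mate M v.
by have := maxM _ (matching_extend mM uM vM auv); rewrite cardsU1 uM ltnn.
Qed.

(** Trading [vw] for [uv] keeps the size and frees [w]. Thus every edge at a missed vertex lies in
    some maximum matching, and being missed by some maximum matching spreads from [u] to [w]. *)
Lemma max_matching_swap M u v w : max_matching A M -> missed M u -> adj A u v ->
  [set v; w] \in M ->
  max_matching A ([set u; v] |: M :\ [set v; w]) /\ missed ([set u; v] |: M :\ [set v; w]) w.
Proof.
move=> /max_matchingP[mM maxM] uM auv vwM; have /matchingP[sub dis] := mM.
have avw := matching_adj mM vwM; have vw := forest_neq fA avw.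
have uN : missed (M :\ [set v; w]) u by move=> x; rewrite !inE negb_and (uM x) orbT.
have wuv : w != u by apply: contraTneq vwM => ->; rewrite setUC uM.
have only y x : y \in [set v; w] -> [set y; x] \in M -> [set y; x] = [set v; w].
  by move=> yvw yxM; apply: (dis _ _ y) => //; rewrite set21.
have vN : missed (M :\ [set v; w]) v.
  by move=> x; rewrite in_setD1; apply/negP => /andP[/eqP ne /only]; rewrite set21 => /(_ isT).
split.
  apply/max_matchingP; split=> [|M' /maxM].
    apply: matching_extend => //; apply/matchingP; split=> [E|E F x]; rewrite !in_setD1.
      by move=> /andP[_ /sub].
    by move=> /andP[_ EM] /andP[_ FM]; apply: dis.
  by rewrite cardsU1 uN (cardsD1 [set v; w] M) vwM.
move=> x; rewrite in_setU1 in_setD1; apply/negP => /orP[/eqP/set2_eq[[wu]|[wv]]|].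
- by rewrite wu eqxx in wuv.
- by rewrite wv eqxx in vw.
- by move=> /andP[/eqP ne /only]; rewrite set22 => /(_ isT).
Qed.

Lemma alt_path_edge M u v : max_matching A M -> [set u; v] \in M -> [set u; v] \in alt_paths A.
Proof.
move=> maxM uvM; have /max_matchingP[mM _] := maxM; have auv := matching_adj mM uvM.
rewrite inE; apply/asboolP; exists u, [:: v], M; split=> //.
  by rewrite /is_path /= inE andbT (forest_neq fA auv) auv.
by rewrite /alternating /= uvM.
Qed.

(** Uniqueness of mates shows that [bc] is unmatched and, with [a != c], that the four vertices are
    distinct. *)
Lemma alt_path_three M a b c d : max_matching A M -> [set a; b] \in M -> [set c; d] \in M ->
  adj A b c -> a != c -> [set a; d] \in alt_paths A.
Proof.
move=> maxM abM cdM abc ac; have /max_matchingP[mM _] := maxM.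
have aab := matching_adj mM abM; have acd := matching_adj mM cdM.
have bcM : [set b; c] \notin M.
  apply/negP => bcM; case/eqP: ac; apply: matching_mate mM _ bcM; by rewrite setUC.
have dM x : [set d; x] \in M -> x = c.
  by move=> dxM; apply: matching_mate mM dxM _; rewrite setUC.
rewrite inE; apply/asboolP; exists a, [:: b; c; d], M; split=> //.
  rewrite /is_path /= aab abc acd !inE !negb_or (forest_neq fA aab) ac (forest_neq fA abc).
  rewrite (forest_neq fA acd) !andbT /=; apply/andP; split; apply/negP => /eqP E; subst d.
    by move: (dM _ abM) abc => <-; rewrite /adj eqxx.
  by move: ac; rewrite (dM a) ?eqxx // setUC.
by rewrite /alternating /= abM (negPf bcM) cdM.
Qed.

(** If a maximum matching missed no vertex, a null vector would yield an endless walk: the matched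
    edge from a vertex of its support, then an unmatched edge back into the support by
    [null_other]. *)
Lemma singular_missed : exists u M, max_matching A M /\ missed M u.
Proof.
have [M maxM] := max_matching_exists; have /max_matchingP[mM _] := maxM.
apply: contrapT => nmiss; have [u [z [zA zu]]] := singular_null_at.
have mate v : exists w, [set v; w] \in M.
  by have [vM|//] := missed_or_mate M v; case: nmiss; exists v, M.
have [v uvM] := mate u.
pose W a b := adj A a b /\
  (z 0 a != 0 /\ [set a; b] \in M \/ z 0 b != 0 /\ [set a; b] \notin M).
suff nW : ~ W u v by apply: nW; split; [exact: matching_adj uvM|left].
apply: (@forest_no_walk _ _ fA W) => [a b []//|a b [aab [[za abM]|[zb abM]]]].
  have [c [ca abc zc]] := null_other wA zA za aab; exists c; split=> //; split=> //.
  right; split=> //; apply/negP => bcM; case/eqP: ca.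
  by apply: matching_mate mM bcM _; rewrite setUC.
have [c bcM] := mate b; exists c; split.
  by apply: contraNneq abM => <-; rewrite setUC.
by split; [exact: matching_adj bcM|left].
Qed.

(** [star_or_many] with [P1] the edges lying in some maximum matching and [D] the vertices missed by
    some maximum matching. *)
Lemma star_or_many_alt_paths : star A \/ (#|edges A| < #|alt_paths A|)%N.
Proof.
pose P1 := [set E : {set 'I_n} | `[< exists M, max_matching A M /\ E \in M >]].
have inP1 u v M : max_matching A M -> [set u; v] \in M -> [set u; v] \in P1.
  by move=> maxM uvM; rewrite inE; apply/asboolP; exists M.
have esym := forest_sym fA.
apply: (@star_or_many _ _ fA conA P1 _
  (fun u => exists M, max_matching A M /\ missed M u)).
- move=> u v _; rewrite inE => /asboolP[M [maxM uvM]]; exact: alt_path_edge uvM.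
- move=> u v auv [M [maxM uM]]; have [w vwM] := max_matching_mate maxM uM auv.
  have [maxN _] := max_matching_swap maxM uM auv vwM.
  by apply: inP1 maxN _; rewrite setU11.
- move=> u v u' auv auu' u'v; rewrite inE => /asboolP[M [maxM uu'M]] nDv.
  have [vM|[v' vv'M]] := missed_or_mate M v; first by case: nDv; exists M.
  have /max_matchingP[mM _] := maxM; rewrite setUC in uu'M.
  exists v'; split; last by apply: alt_path_three uu'M vv'M _ _.
    apply: contraNneq u'v => v'u; subst v'; apply/eqP.
    by apply: matching_mate mM _ _; rewrite setUC; [exact: uu'M|exact: vv'M].
  exact: matching_adj vv'M.
- move=> v a y [M [maxM vM]] ava avy ay; have [w awM] := max_matching_mate maxM vM ava.
  have [y' yy'M] := max_matching_mate maxM vM avy.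
  have /max_matchingP[mM _] := maxM.
  have y'v : y' != v by apply: contraTneq yy'M => ->; rewrite setUC vM.
  (* After trading [aw] for [va], the path [a v y y'] alternates. *)
  have [maxN _] := max_matching_swap maxM vM ava awM.
  exists y'; split=> //; first exact: matching_adj yy'M.
  apply: (alt_path_three maxN _ _ avy ay); first by rewrite setUC setU11.
  rewrite in_setU1 in_setD1 yy'M andbT; apply/orP; right.
  apply/negP => /eqP/set2_eq[[ya _]|[yw y'a]]; first by rewrite ya eqxx in ay.
  by subst y'; have /negP[] := forest_no_triangle fA avy ava; apply: matching_adj yy'M.
- move=> u nDu; have [M maxM] := max_matching_exists.
  have /max_matchingP[mM _] := maxM.
  have [uM|[u' uu'M]] := missed_or_mate M u; first by case: nDu; exists M.
  by exists u'; split; [exact: matching_adj uu'M|exact: inP1 uu'M].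
- move=> d a [M [maxM dM]] ada; have [w awM] := max_matching_mate maxM dM ada.
  have /max_matchingP[mM _] := maxM.
  have [maxN wN] := max_matching_swap maxM dM ada awM.
  exists w; split; last by exists ([set d; a] |: M :\ [set a; w]).
    by apply: contraTneq awM => ->; rewrite setUC dM.
  exact: matching_adj awM.
- by have [u [M uM]] := singular_missed; exists u, M.
Qed.

End SingularTree.

(** * Stars: group inverse and alternating paths *)

Section Star.
Variables (R : realType) (n : nat) (A X : 'M[R]_n) (c : 'I_n).
Hypotheses (wA : wgraph A) (starA : forall i j, adj A i j -> (i == c) || (j == c)).

Lemma star_entry i j : i != c -> j != c -> A i j = 0.
Proof.
move=> ic jc; apply/eqP/negPn/negP; rewrite -adj_entry // => /starA.
by rewrite (negPf ic) (negPf jc).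
Qed.

(** Row [c] of [A *m A] is the sum of squared weights times the unit vector at [c], and [A] lives on
    row and column [c]. *)
Lemma star_cube : A *m A *m A = (\sum_k A c k ^+ 2) *: A.
Proof.
have Acc : A c c = 0 by case: wA.
have sqr k : (A *m A) c k = (c == k)%:R * \sum_k A c k ^+ 2.
  rewrite mxE; have [<-|ck] := eqVneq c k.
    by rewrite mul1r; apply: eq_bigr => j _; rewrite expr2 [A j c]wgraph_entryC.
  rewrite mul0r big1 // => j _; have [->|jc] := eqVneq j c; first by rewrite Acc mul0r.
  by rewrite [A j k]star_entry ?mulr0 // eq_sym.
apply/matrixP => i k; rewrite [RHS]mxE; have [->|ic] := eqVneq i c.
  rewrite mxE (bigD1 c) //= big1 => [|j jc]; last by rewrite sqr eq_sym (negPf jc) !mul0r.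
  by rewrite sqr eqxx mul1r addr0.
rewrite -mulmxA mxE (bigD1 c) //= big1 => [|j jc]; last by rewrite star_entry ?mul0r.
rewrite sqr addr0; have [<-|ck] := eqVneq c k; first by rewrite mul1r mulrC.
by rewrite mul0r mulr0 star_entry ?mulr0 // eq_sym.
Qed.

Lemma star_group_inverse : group_inverse A X -> exists2 t, t != 0 & X = t *: A.
Proof.
move=> gi; pose s := \sum_k A c k ^+ 2.
(* The degenerate case [A = 0], as for a single vertex: then [X = 0] and the scalar 1 serves. *)
have [s0|s0] := eqVneq s 0.
  have Ac k : A c k = 0.
    apply/eqP; rewrite -sqrf_eq0; apply/eqP.
    by apply: (psumr_eq0P _ s0) => // i _; apply: sqr_ge0.
  have A0 : A = 0.
    apply/matrixP => i j; rewrite mxE; have [->//|ic] := eqVneq i c.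
    by have [->|jc] := eqVneq j c; [rewrite wgraph_entryC|apply: star_entry].
  exists 1; first exact: oner_neq0.
  by case: gi => _ <- _; rewrite A0 mulmx0 mul0mx scaler0.
exists s^-1; first by rewrite invr_eq0.
apply: (group_inverse_unique gi); split; rewrite -?scalemxAl -?scalemxAr -?scalemxAl //.
  by rewrite star_cube scalerA mulVf ?scale1r.
by rewrite star_cube [_ *: (_ *: A)]scalerA mulVf ?scale1r.
Qed.

(** Alternating paths have odd length, and from three edges on the first and third are disjoint, so
    they cannot both contain [c]. *)
Lemma star_alt_paths : wtree A -> alt_paths A = edges A.
Proof.
move=> tA; have fA := wtree_forest tA; apply/setP => S; apply/idP/idP.
  rewrite inE => /asboolP[u [q [M [_ /and3P[q0 uq pq] /andP[oq _] ->]]]].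
  case: q q0 uq pq oq => [//|v [|x [//|y q]]] _ uq pq _.
    by rewrite (mem_edge_set u v (forest_sym fA)); case/andP: pq.
  case/and4P: pq => /starA uv _ /starA xy _; move: uq; rewrite /= !inE !negb_or.
  by case/orP: uv => /eqP ->; case/orP: xy => /eqP ->; rewrite eqxx ?andbF.
case/edge_setP=> [i [j [aij ->]]].
(* All edges share [c], so a single edge is already a maximum matching. *)
apply: (alt_path_edge tA (M := [set [set i; j]])); last by rewrite inE.
apply/max_matchingP; split.
  apply/matchingP; split=> [E|E F x]; rewrite !in_set1 => /eqP ->.
    by rewrite (mem_edge_set i j (forest_sym fA)).
  by move=> /eqP ->.
move=> M /matchingP[sub dis]; rewrite cards1; apply/card_le1_eqP => E F EM FM.
have cin G : G \in M -> c \in G.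
  by move=> /sub/edge_setP[x [y [/starA xy ->]]]; rewrite !inE ![c == _]eq_sym.
by apply: (dis F E c) => //; apply: cin.
Qed.

End Star.

(** * Isomorphic graphs and the cycle of implications *)

Lemma wgraph_iso_card_edges (R : realType) (n : nat) (A X : 'M[R]_n) :
  wgraph_iso A X -> (#|edges X| <= #|edges A|)%N.
Proof.
case=> s iso; rewrite -(card_imset _ (imset_inj (@perm_inj _ s))); apply/subset_leq_card/subsetP.
move=> _ /imsetP[_ /edge_setP[i [j [aij ->]]] ->].
by apply/edge_setP; exists (s i), (s j); rewrite imsetU1 imset_set1 -iso.
Qed.

Theorem theorem2p12 (R : realType) (n : nat) (A Ag : 'M[R]_n) :
  wtree A -> singular A -> group_inverse A Ag ->
  [<-> #|alt_paths A| = n.-1;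
       wtree Ag;
       star A;
       wgraph_iso A Ag].
Proof.
move=> tA sA gi; have fA := wtree_forest tA; have cardA := wtree_card_edges tA.
have wA : wgraph A by case: tA.
have star_adj : star A -> adj Ag = adj A.
  move=> [c cA]; have [t t0 ->] := star_group_inverse wA cA gi.
  apply/funext => i; apply/funext => j.
  by rewrite /adj mxE mulf_eq0 (negPf t0).
(* Both (ii) and (iv) bound the number of edges of [Ag] by [n.-1], and reach (iii) this way. *)
have star_of_le : (#|edges Ag| <= n.-1)%N -> star A.
  by have [//|] := star_or_many_inverse_edges tA sA gi; rewrite cardA ltnNge => /negPf ->.
have star_of_alt : #|alt_paths A| = n.-1 -> star A.
  by have [//|] := star_or_many_alt_paths tA sA; rewrite cardA => lt E; rewrite E ltnn in lt.
tfae.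
- move=> /star_of_alt/[dup] stA /star_adj adjX; case: tA => n0 _ conA acA.
  split=> //; first last.
  + by rewrite /acyclic adjX.
  + by rewrite /connected adjX.
  have [c cA] := stA; have [t _ ->] := star_group_inverse wA cA gi.
  by case: wA => At A0; split=> [|i]; rewrite ?linearZ /= ?At // mxE A0 mulr0.
- by move=> /wtree_card_edges E; apply: star_of_le; rewrite E.
- by move=> /star_adj adjX; exists 1%g => i j; rewrite adjX !perm1.
- move=> /wgraph_iso_card_edges; rewrite cardA => /star_of_le[c cA].
  by rewrite (star_alt_paths cA tA) cardA.
Qed.
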